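(* There exists a constant $c$ such that for every positive integer $k$, every Hamiltonian graph $G$ on $n \ge c k^{7/3}$ vertices with $\alpha(G) \le k$ contains a cycle of length $n-1$.
   Context: Graphs are finite and simple. $\alpha(G)$ denotes the independence number of $G$, i.e. the order of a maximum independent set. A graph is Hamiltonian if it contains a cycle passing through every vertex exactly once. *)

(* Defs.v *)
From mathcomp Require Import all_boot.

Set Implicit Arguments.
Unset Strict Implicit.
Unset Printing Implicit Defensive.

(* A finite simple graph is a symmetric irreflexive relation e on a finType T. *)

Section Graph.
Variables (T : finType) (e : rel T).

Definition simple_graph : Prop := symmetric e /\ irreflexive e.

Definition independent (S : {set T}) : bool :=
  [forall x in S, forall y in S, ~~ e x y].

Definition independence_number : nat :=
  \max_(S : {set T} | independent S) #|S|.

(* [ucycle] alone also accepts the empty sequence and, for symmetric e, a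
   single edge traversed back and forth; the bound on the size excludes both. *)
Definition graph_cycle (s : seq T) : Prop := 2 < size s /\ ucycle e s.

Definition has_cycle_of_length (m : nat) : Prop :=
  exists2 s : seq T, graph_cycle s & size s = m.

Definition hamiltonian : Prop :=
  exists2 s : seq T, graph_cycle s & forall x : T, x \in s.

End Graph.

(* Main.v *)
(** Suppose there is no cycle of length n - 1.  A cycle missing between 1 and 6w
vertices, all of degree > k + 6w, would grow by Chvatal-Erdos insertions into
one of length n - 1, and all but O(k^2) of the consecutive blocks of length
w ~ k^(1/3) of the Hamilton cycle contain only such vertices.  Chords between
these clean blocks therefore cannot be rerouted into a cycle skipping a few
block vertices.  Give the edge joining the vertices of offset 2c of two blocks
the colour c: each pair of blocks carries at most one colour.  Looking at
triangles of blocks with two colours s <> t at the apex and an edge between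
offsets below s and t, a shortest such triangle is followed by an apex A
for which the other blocks split into two ranges without any.  So in each range
the colour classes of neighbours of A send no low-offset edges to one another
and their independence numbers add up; one of the classes is a large family of
blocks with independence number smaller by a factor ~ k^(1/3).  After two such
steps the family is too dense to have one colour per pair. *)

Require Import Defs.
From mathcomp Require Import all_boot all_order all_algebra.
From mathcomp Require Import zify boolp reals exp.

Import Order.TTheory GRing.Theory Num.Theory.

Set Implicit Arguments.
Unset Strict Implicit.
Unset Printing Implicit Defensive.

(** * Degenerate relations and their independent sets *)

Section Degenerate.
Variables (V : finType) (r : rel V).
Hypothesis r_sym : symmetric r.
Hypothesis r_irr : irreflexive r.

(** This form of degeneracy needs no ordering of the vertices and passes to subsets. The bound is
    strict so that a vertex together with its neighbours costs at most d. *)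
Definition degenerate (d : nat) (S : {set V}) : Prop :=
  forall S' : {set V}, S' \subset S -> S' != set0 ->
  exists2 x, x \in S' & #|[set y in S' | r x y]| < d.

Lemma independentU1 x (X : {set V}) :
  independent r X -> (forall y, y \in X -> ~~ r x y) ->
  independent r (x |: X).
Proof.
move=> /'forall_in_'forall_in_idP-indX rX.
apply/'forall_in_'forall_in_idP => y /setU1P[->|Xy] z /setU1P[->|Xz].
- by rewrite r_irr.
- exact: rX.
- by rewrite r_sym rX.
- exact: indX.
Qed.

(** Greedy choice: a vertex of degree < d is kept and its neighbours are deleted, so each kept
    vertex uses up at most d vertices of S. *)
Lemma degenerate_independent d (S : {set V}) : degenerate d S ->
  exists X : {set V}, [/\ X \subset S, independent r X & #|S| <= d * #|X|].
Proof.
have [m] := ubnP #|S|; elim: m S => // m IHm S leSm degS.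
have [->|S0] := eqVneq S set0.
  exists set0; rewrite sub0set cards0; split=> //.
  by apply/'forall_in_idP => x; rewrite inE.
have [x Sx ltd] := degS S (subxx _) S0.
pose S1 := S :\: (x |: [set y in S | r x y]).
have sS1 : S1 \subset S := subsetDl _ _.
have card_nb : #|x |: [set y in S | r x y]| <= d by rewrite cardsU1; lia.
have cardS : #|S| <= d + #|S1|.
  rewrite -(cardsID (x |: [set y in S | r x y]) S) leq_add2r.
  by apply: leq_trans card_nb; apply/subset_leq_card/subsetIr.
have ltS1 : #|S1| < m.
  rewrite -ltnS (leq_trans _ leSm) // ltnS; apply: proper_card.
  by apply/properP; split=> //; exists x => //; rewrite !inE eqxx.
have degS1 : degenerate d S1.
  by move=> S' sS'; apply: degS; apply: subset_trans sS1.
have [X [sX indX leX]] := IHm S1 ltS1 degS1.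
have XxF : x \notin X.
  by apply/negP => /(subsetP sX); rewrite !inE eqxx.
exists (x |: X); split.
- by rewrite subUset sub1set Sx (subset_trans sX).
- apply: independentU1 => // y /(subsetP sX); rewrite !inE.
  by case/andP=> /norP[_]; rewrite negb_and => /orP[/negP|//].
- by rewrite cardsU1 XxF mulnDr muln1; lia.
Qed.

End Degenerate.

(* Otherwise blocks can be removed one by one, each being of degree < d, when
   it is removed, in more than half of the relations; then some relation is
   d-degenerate on half of B. *)
Lemma many_relations_with_large_degree (V : finType) (h d kappa : nat)
    (r : 'I_h -> rel V) (B : {set V}) :
    (forall c, symmetric (r c)) -> (forall c, irreflexive (r c)) ->
    (forall c (X : {set V}), X \subset B -> independent (r c) X ->
       #|X| <= kappa) ->
    2 * d * kappa < #|B| ->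
  exists B' : {set V}, [/\ B' \subset B, B' != set0 &
    forall x, x \in B' ->
      h <= 2 * #|[set c | d <= #|[set y in B' | r c x y]|]|].
Proof.
move=> r_sym r_irr kappaB ltB; apply: contrapT => noB'.
pose bad (S : {set V}) x := [set c | #|[set y in S | r c x y]| < d].
have has_bad (S : {set V}) : S \subset B -> S != set0 ->
    exists2 x, x \in S & h < 2 * #|bad S x|.
  move=> sSB S0; apply: contrapT => nobad; apply: noB'; exists S; split=> //.
  move=> x Sx; rewrite leqNgt; apply/negP => lth; apply: nobad; exists x => //.
  have -> : bad S x = ~: [set c | d <= #|[set y in S | r c x y]|].
    by apply/setP => c; rewrite !inE ltnNge.
  have := cardsC [set c | d <= #|[set y in S | r c x y]|].
  by rewrite card_ord; lia.
(* [F c] collects the vertices that had small degree in relation c at the moment of their removal;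
   each removal enlarges more than half of the sets [F c]. *)
have peel m (S : {set V}) : #|S| = m -> S \subset B ->
    exists F : 'I_h -> {set V},
    [/\ forall c, F c \subset S, forall c, degenerate (r c) d (F c)
      & h * #|S| <= 2 * \sum_c #|F c|].
  elim: m S => [|m IHm] S cardS sSB.
    exists (fun=> set0); split=> [c|c S' sS'|]; rewrite ?sub0set ?cardS //.
      by rewrite -subset0 sS'.
    by rewrite muln0.
  have S0 : S != set0 by rewrite -card_gt0 cardS.
  have [x Sx ltbad] := has_bad S sSB S0.
  have cardS1 : #|S :\ x| = m.
    by move: cardS; rewrite (cardsD1 x) Sx add1n => -[].
  have [F [sF degF sumF]] := IHm _ cardS1 (subset_trans (subsetDl _ _) sSB).
  exists (fun c => if c \in bad S x then x |: F c else F c); split.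
  - move=> c; have sFS := subset_trans (sF c) (subsetDl S [set x]).
    by case: ifP => _ //; rewrite subUset sub1set Sx.
  - move=> c; case: ifPn => [bc|_]; last exact: degF.
    move=> S' sS' S'0; have [xS'|xS'] := boolP (x \in S'); last first.
      apply: degF S'0; apply/subsetP => y yS'.
      have /setU1P[yx|//] := subsetP sS' y yS'.
      by rewrite -yx yS' in xS'.
    exists x => //; move: bc; rewrite inE; apply: leq_ltn_trans.
    apply/subset_leq_card/subsetP => y; rewrite !inE => /andP[yS' ->].
    rewrite andbT; have /setU1P[->//|yF] := subsetP sS' y yS'.
    by have /setD1P[] := subsetP (sF c) y yF.
  - have -> : \sum_c #|if c \in bad S x then x |: F c else F c|
        = \sum_c #|F c| + #|bad S x|.
      rewrite -[#|bad S x|]sum1_card (big_mkcond (mem (bad S x))) -big_split /=.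
      apply: eq_bigr => c _.
      case: ifP => _; last by rewrite addn0.
      rewrite cardsU1; suff -> : x \notin F c by rewrite addnC.
      by apply/negP => /(subsetP (sF c)); rewrite !inE eqxx.
    by move: cardS sumF; rewrite (cardsD1 x) Sx cardS1 mulnDr mulnDr muln1; lia.
have [F [sF degF sumF]] := peel _ B erefl (subxx _).
have F_le c : #|F c| <= d * kappa.
  have [X [sX indX leX]] := degenerate_independent (r_sym c) (r_irr c) (degF c).
  by rewrite (leq_trans leX) // leq_mul2l (kappaB c) ?orbT // (subset_trans sX).
have [x xB] : exists x, x \in B.
  by apply/set0Pn; rewrite -card_gt0; lia.
have [h0|h_gt0] := posnP h.
  apply: noB'; exists B; split=> //; first by apply/set0Pn; exists x.
  by move=> y _; rewrite [X in X <= _]h0.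
have sum_le : \sum_c #|F c| <= h * (d * kappa).
  rewrite -[X in X * _](card_ord h) -sum_nat_const; exact: leq_sum.
have : h * #|B| <= h * (2 * d * kappa) by move: sumF sum_le; nia.
by rewrite leq_pmul2l //; lia.
Qed.

(** * Rerouted walks and insertion of vertices into a cycle *)

Section Walks.
Variables (T : finType) (e : rel T).
Hypothesis e_sym : symmetric e.
Hypothesis e_irr : irreflexive e.

(** With both ends as parameters, a rerouted cycle can be glued arc by arc along chords and closed
    by a last edge. *)
Definition walk (a b : T) (s : seq T) : bool :=
  if s is z :: s' then [&& z == a, path e z s' & last z s' == b] else false.

Lemma walk_cat a b c d s1 s2 :
  walk a b s1 -> e b c -> walk c d s2 -> walk a d (s1 ++ s2).
Proof.
case: s1 => [|z s1] //= /and3P[za ps1 /eqP lb] ebc.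
case: s2 => [|y s2] //= /and3P[/eqP -> ps2 ld].
by rewrite za cat_path last_cat /= ps1 lb ebc ps2.
Qed.

Lemma walk_rev a b s : walk a b s -> walk b a (rev s).
Proof.
case: s => [|z s] //= /and3P[/eqP za ps /eqP lb].
rewrite lastI rev_rcons /= lb eqxx -{1}lb rev_path /=; apply/andP; split.
  by rewrite (@eq_path _ (fun z => e^~ z) e) // => x y; rewrite e_sym.
case: s {ps} lb => [<-|y s _]; first by rewrite za eqxx.
by rewrite /= rev_cons last_rcons za.
Qed.

Lemma walk1 a : walk a a [:: a].
Proof. by rewrite /= eqxx. Qed.

Lemma walk_cycle a b s : walk a b s -> e b a -> cycle e s.
Proof.
case: s => [|z s] //= /and3P[/eqP -> ps /eqP lb] eba.
by rewrite rcons_path ps lb.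
Qed.

Lemma not_independent_edge k (X : {set T}) : independence_number e <= k ->
  k < #|X| -> exists x y, [/\ x \in X, y \in X & e x y].
Proof.
move=> alpha_k ltX; have : ~~ independent e X.
  apply/negP => indX; move: ltX; rewrite ltnNge => /negP; apply.
  by apply: leq_trans alpha_k; apply: leq_bigmax_cond.
case/forall_inPn => x Xx /forall_inPn[y Xy]; rewrite negbK => exy.
by exists x, y.
Qed.

(* With y1, y2 the successors on the cycle of two neighbours b2, b1 of x,
   the cycle y1 ... b1 y2 ... b2 becomes x b2 ... y2 y1 ... b1. *)
Lemma insert_vertex k (s : seq T) x : independence_number e <= k ->
    ucycle e s -> x \notin s -> k < #|[set y in s | e x y]| ->
  exists2 s', ucycle e s' & perm_eq s' (x :: s).
Proof.
move=> alpha_k /andP[cyc_s uniq_s] xs ltN.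
pose Y := [set next s y | y in [set y in s | e x y]].
have [|y1 [y2 [/imsetP[b2]]]] := @not_independent_edge k Y alpha_k.
  rewrite card_imset //; exact: (can_inj (prev_next uniq_s)).
rewrite inE => /andP[b2s xb2] y1E /imsetP[b1]; rewrite inE => /andP[b1s xb1] y2E.
move=> y12.
have b2E : prev s y1 = b2 by rewrite y1E prev_next.
have b1E : prev s y2 = b1 by rewrite y2E prev_next.
have y1s : y1 \in s by rewrite y1E mem_next.
have y2s : y2 \in s by rewrite y2E mem_next.
have y21 : y2 != y1 by apply: contraTneq y12 => ->; rewrite e_irr.
case: (rot_to y1s) => i s' rotE.
have uniq_r : uniq (y1 :: s') by rewrite -rotE rot_uniq.
have cyc_r : cycle e (y1 :: s') by rewrite -rotE rot_cycle.
have prevE y : prev (y1 :: s') y = prev s y by rewrite -rotE prev_rot.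
have : y2 \in y1 :: s' by rewrite -rotE mem_rot.
rewrite inE (negbTE y21) /= => y2s'.
case/splitPr: y2s' => p1 p2 in rotE uniq_r cyc_r prevE.
have perm_s : perm_eq s (y1 :: p1 ++ y2 :: p2) by rewrite -rotE perm_sym perm_rot.
have last1 : last y1 p1 = b1.
  rewrite -b1E -prevE prev_nth !inE mem_cat !inE eqxx !orbT index_cat.
  have -> : (y2 \in p1) = false.
    apply/negbTE; move: uniq_r; rewrite /= cat_uniq => /and4P[_ _ /norP[]//].
  by rewrite /= eqxx addn0 -cat_cons nth_cat /= ltnSn nth_last.
have last2 : last y2 p2 = b2.
  rewrite -b2E -prevE prev_nth inE eqxx /= memNindex; last by case/andP: uniq_r.
  by rewrite -[size _]/((size (y1 :: p1 ++ y2 :: p2)).-1) nth_last /= last_cat.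
move: cyc_r; rewrite /= rcons_path cat_path /= => /andP[/and3P[path1 _ path2] _].
have cyc' : cycle e ([:: x] ++ rev (y2 :: p2) ++ (y1 :: p1)).
  apply: (@walk_cycle x b1); last by rewrite e_sym.
  apply: (walk_cat (walk1 x) xb2).
  apply: (@walk_cat _ y2 y1); last by rewrite /= eqxx path1 last1 /=.
    by apply: walk_rev; rewrite /= eqxx path2 last2 /=.
  by rewrite e_sym.
have perm' : perm_eq ([:: x] ++ rev (y2 :: p2) ++ (y1 :: p1)) (x :: s).
  rewrite /= perm_cons perm_sym (perm_trans perm_s) // perm_sym.
  by rewrite perm_catC -cat_cons perm_cat2l perm_rev.
exists ([:: x] ++ rev (y2 :: p2) ++ (y1 :: p1)) => //.
by rewrite /ucycle cyc' (perm_uniq perm') /= xs.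
Qed.

(** Vertices are inserted one at a time until a single one is missing. At most m vertices are ever
    off the cycle, so a missing vertex of degree > k + m has more than k neighbours on it, as
    [insert_vertex] requires. *)
Lemma reinsert k m (s : seq T) : independence_number e <= k ->
    ucycle e s -> 2 < size s -> size s < #|T| -> #|T| <= size s + m ->
    (forall x, x \notin s -> k + m < #|[set y | e x y]|) ->
  has_cycle_of_length e (#|T| - 1).
Proof.
move=> alpha_k; have [l] := ubnP (#|T| - size s).
elim: l s => // l IHl s lel cyc_s gt2 ltT leT high.
have [eqT|neT] := eqVneq (size s) (#|T| - 1); first by exists s.
have uniq_s : uniq s by case/andP: cyc_s.
have card_s : #|[set y in s]| = size s by rewrite cardsE; apply/card_uniqP.
have [x] : exists x, x \in ~: [set y in s].
  by apply/set0Pn; rewrite -card_gt0; have := cardsC [set y in s]; lia.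
rewrite !inE => xs.
have ltN : k < #|[set y in s | e x y]|.
  have := high x xs; rewrite -(cardsID [set y in s] [set y | e x y]).
  have -> : [set y | e x y] :&: [set y in s] = [set y in s | e x y].
    by apply/setP => y; rewrite !inE andbC.
  have : #|[set y | e x y] :\: [set y in s]| <= #|~: [set y in s]|.
    by apply/subset_leq_card/subsetP => y; rewrite !inE => /andP[].
  by have := cardsC [set y in s]; lia.
have [s' cyc' perm'] := insert_vertex alpha_k cyc_s xs ltN.
have size' := perm_size perm'; rewrite /= in size'.
apply: IHl cyc' _ _ _ _; rewrite ?size'; try lia.
by move=> y; rewrite (perm_mem perm') inE => /norP[_]; apply: high.
Qed.

End Walks.

(** * Rerouting the Hamilton cycle around gaps *)

Section HamiltonCycle.
Variables (T : finType) (e : rel T).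
Hypothesis e_sym : symmetric e.
Hypothesis e_irr : irreflexive e.
(** The Hamilton cycle is unrolled into a periodic sequence, so that arcs through the origin are
    ordinary intervals of positions. *)
Variable u : nat -> T.
Hypothesis u_edge : forall i, e (u i) (u i.+1).
Hypothesis u_periodic : forall i, u (i + #|T|) = u i.
Hypothesis u_inj : forall b, {in [pred i | b <= i < b + #|T|] &, injective u}.

Variables k w : nat.
Hypothesis alpha_k : independence_number e <= k.
Hypothesis T_large : 6 * w + 2 < #|T|.
Hypothesis no_cycle : ~ has_cycle_of_length e (#|T| - 1).

(** The margin [6 * w] allows for six gaps, each skipping fewer than w vertices. *)
Definition high (x : T) : bool := k + 6 * w < #|[set y | e x y]|.

(** A rerouting keeps both ends and skips what lies strictly between. Since [i.+2 <= j], at least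
    one vertex is skipped, so the rerouted cycle is not Hamiltonian. *)
Definition gap (i j : nat) : Prop :=
  [/\ i.+2 <= j, j <= i + w & forall p, i < p < j -> high (u p)].

Definition seg (i j : nat) : seq nat := iota i (j - i).+1.

Lemma walk_seg i j : i <= j -> walk e (u i) (u j) (map u (seg i j)).
Proof.
move=> /subnK; rewrite /seg; move: (j - i) => m <-.
elim: m i => [|m IHm] i; first by rewrite /= !eqxx.
have := IHm i.+1; rewrite addnS /= addSn !eqxx u_edge /=.
by case/andP=> /= -> ->.
Qed.

Lemma walk_rev_seg i j : i <= j -> walk e (u j) (u i) (map u (rev (seg i j))).
Proof. by move=> leij; rewrite map_rev; apply: walk_rev (walk_seg leij). Qed.

(** The closing edge would make a cycle whose missing vertices are few and all high, and [reinsert]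
    would extend it to length [#|T| - 1]. *)
Lemma no_short_walk (b : nat) (P : seq nat) (x y : T) :
    uniq P -> {subset P <= [pred p | b <= p < b + #|T|]} ->
    (forall p, b <= p < b + #|T| -> p \notin P -> high (u p)) ->
    size P < #|T| -> #|T| <= size P + 6 * w ->
  walk e x y (map u P) -> ~~ e y x.
Proof.
move=> uniqP subP highP ltP leP walkP; apply/negP => eyx; apply: no_cycle.
have uniq_uP : uniq (map u P).
  by rewrite map_inj_in_uniq // => p q /subP bp /subP bq; apply: (u_inj (b := b)).
apply: (@reinsert _ e e_sym e_irr k (6 * w) (map u P)) => //.
- by rewrite /ucycle uniq_uP andbT (walk_cycle walkP).
- by rewrite size_map; lia.
- by rewrite size_map.
- by rewrite size_map.
move=> z zP; have uniq_win : uniq (map u (iota b #|T|)).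
  rewrite map_inj_in_uniq ?iota_uniq // => p q.
  by rewrite !mem_iota => bp bq; apply: (u_inj (b := b)).
have : z \in map u (iota b #|T|).
  have cardE : #|map u (iota b #|T|)| = #|T|.
    by rewrite (card_uniqP uniq_win) size_map size_iota.
  by rewrite (subset_cardP cardE (subset_predT _)).
case/mapP=> p; rewrite mem_iota => bp zE; rewrite zE.
by apply: highP => //; apply: contra zP => pP; rewrite zE map_f.
Qed.

(** Lists the kept positions in increasing order. Rerouted cycles are compared with it only up to
    permutation, so distinctness, size and skipped vertices are treated once for all reroutings. *)
Fixpoint segs (p : nat) (gs : seq (nat * nat)) (q : nat) : seq nat :=
  if gs is (x, x') :: gs' then seg p x ++ segs x' gs' q else seg p q.

Fixpoint gaps_between (p : nat) (gs : seq (nat * nat)) (q : nat) : Prop :=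
  if gs is (x, x') :: gs' then [/\ p <= x, gap x x' & gaps_between x' gs' q]
  else p <= q.

Lemma segs_cons p x x' gs q :
  segs p ((x, x') :: gs) q = seg p x ++ segs x' gs q.
Proof. by []. Qed.

Lemma mem_seg p q r : p <= q -> (r \in seg p q) = (p <= r <= q).
Proof. by move=> pq; rewrite mem_iota addnS ltnS subnKC. Qed.

Lemma gaps_between_le p gs q : gaps_between p gs q -> p <= q.
Proof.
elim: gs p => [|[x x'] gs IHgs] p //= [px [xx' _ _] /IHgs].
by apply: leq_trans; apply: leq_trans px (ltnW (ltnW xx')).
Qed.

Lemma mem_segs_range p gs q r :
  gaps_between p gs q -> r \in segs p gs q -> p <= r <= q.
Proof.
elim: gs p => [|[x x'] gs IHgs] p; first by move=> pq; rewrite mem_seg.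
case=> px [xx' _ _] gs_x'; have le_x'q := gaps_between_le gs_x'.
have le_xx' := ltnW (ltnW xx').
rewrite segs_cons mem_cat mem_seg // => /orP[/andP[-> rx]|/(IHgs _ gs_x')/andP[x'r ->]].
  by rewrite (leq_trans rx) // (leq_trans le_xx').
by rewrite andbT (leq_trans px) // (leq_trans le_xx').
Qed.

Lemma segs_uniq p gs q : gaps_between p gs q -> uniq (segs p gs q).
Proof.
elim: gs p => [|[x x'] gs IHgs] p; first by rewrite iota_uniq.
case=> px [xx' _ _] gs_x'; rewrite segs_cons cat_uniq iota_uniq IHgs // andbT.
apply/hasPn => r /(mem_segs_range gs_x')/andP[x'r _].
rewrite /= mem_seg // negb_and -!ltnNge; apply/orP; right.
exact: leq_trans (ltnW xx') x'r.
Qed.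

Lemma high_off_segs p gs q r : gaps_between p gs q ->
  p <= r <= q -> r \notin segs p gs q -> high (u r).
Proof.
elim: gs p => [|[x x'] gs IHgs] p.
  by move=> pq pr; rewrite mem_seg // pr.
case=> px [xx' _ high_gap] gs_x' /andP[pr rq].
rewrite segs_cons mem_cat mem_seg // pr negb_or /= -ltnNge => /andP[xr r_segs].
have [x'r|rx'] := leqP x' r; last by rewrite high_gap // xr.
by apply: (IHgs x') => //; rewrite x'r.
Qed.

Lemma size_segs p gs q : gaps_between p gs q ->
  size (segs p gs q) <= (q - p).+1 <= size (segs p gs q) + size gs * w.
Proof.
elim: gs p => [|[x x'] gs IHgs] p.
  by rewrite size_iota mul0n addn0 leqnn.
case=> px [xx' x'w _] gs_x'; have := IHgs _ gs_x'.
have := gaps_between_le gs_x'; rewrite segs_cons size_cat size_iota mulSn.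
move: (size _ * w) (size (segs _ _ _)) px xx' x'w; clear.
by move=> m l px xx' x'w x'q /andP[]; lia.
Qed.

(** The kept positions run from i' once around to the next copy of i, so the gap from i to i' is
    skipped in addition to those of gs. This makes at most six gaps, the number used by
    [no_two_triangles]. *)
Lemma no_walk_off_gaps i i' gs (P : seq nat) (x y : T) :
    gap i i' -> gaps_between i' gs (i + #|T|) -> size gs <= 5 ->
    perm_eq P (segs i' gs (i + #|T|)) ->
  walk e x y (map u P) -> ~~ e y x.
Proof.
case=> ii' i'w high_gap gs_i' gs5 permP.
have le_i'n := gaps_between_le gs_i'.
have /andP[leP geP] := size_segs gs_i'.
have lt_i'n : (i + #|T| - i').+1 < #|T|.
  have arith a b n : a.+1 < b -> b <= a + n -> (a + n - b).+1 < n.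
    by clear; lia.
  exact: arith.
(* The window of one period starts just after i: it contains the skipped positions before i', and i
   is represented by its copy [i + #|T|]. *)
apply: (@no_short_walk i.+1 P).
- by rewrite (perm_uniq permP) segs_uniq.
- move=> r; rewrite (perm_mem permP) => /(mem_segs_range gs_i')/andP[i'r rn].
  by rewrite inE (leq_trans _ i'r) ?(ltnW ii') // addSn ltnS.
- move=> r /andP[ir rn]; rewrite (perm_mem permP) => r_segs.
  have [i'r|ri'] := leqP i' r; last by rewrite high_gap // ir.
  by apply: high_off_segs gs_i' _ r_segs; rewrite i'r -ltnS -addSn.
- by rewrite (perm_size permP) (leq_ltn_trans leP).
rewrite (perm_size permP).
have gs5w : size gs * w <= 5 * w by rewrite leq_mul2r gs5 orbT.
have arith a b n l m v : b <= a + v -> b <= a + n ->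
    (a + n - b).+1 <= l + m -> m <= 5 * v -> n <= l + 6 * v.
  by clear; lia.
exact: arith i'w le_i'n geP gs5w.
Qed.

(* The cycle is i'..j reversed, j'..i. *)
Lemma no_crossing_chords i i' j j' :
    gap i i' -> gap j j' -> i' <= j -> j' <= i + #|T| ->
  e (u i) (u j) -> ~~ e (u i') (u j').
Proof.
move=> gi gj i'j j'n eij; apply/negP => ei'j'.
move: eij; apply/negP.
apply: (@no_walk_off_gaps i i' [:: (j, j')]
  (rev (seg i' j) ++ seg j' (i + #|T|))) => //.
  by rewrite segs_cons perm_cat2r perm_rev.
rewrite map_cat; apply: walk_cat (walk_rev_seg _) ei'j' _ => //.
by rewrite -[u i]u_periodic; apply: walk_seg.
Qed.

(* The cycle is j'..l, i'..j reversed, l'..i. *)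
Lemma no_interlaced_triangle i i' j j' l l' :
    gap i i' -> gap j j' -> gap l l' ->
    i' <= j -> j' <= l -> l' <= i + #|T| ->
    e (u i) (u j') -> e (u i') (u l') ->
  ~~ e (u j) (u l).
Proof.
move=> gi gj gl i'j j'l l'n eij' ei'l'.
apply/negP => ejl; move: eij'; apply/negP.
apply: (@no_walk_off_gaps i i' [:: (j, j'); (l, l')]
  (seg j' l ++ rev (seg i' j) ++ seg l' (i + #|T|))) => //.
  apply/permP => p; rewrite !segs_cons !count_cat count_rev.
  exact: addnCA.
rewrite !map_cat; apply: (walk_cat (walk_seg _) (b := u l) (c := u j)) => //.
  by rewrite e_sym.
apply: (walk_cat (walk_rev_seg _) ei'l') => //.
by rewrite -[u i]u_periodic; apply: walk_seg.
Qed.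

(* The cycle is i'..a, c'..i, l'..b, b'..c reversed, a'..j, j'..l reversed. *)
Lemma no_two_triangles i i' a a' j j' l l' b b' c c' :
    gap i i' -> gap a a' -> gap j j' -> gap l l' -> gap b b' -> gap c c' ->
    i' <= a -> a' <= j -> j' <= l -> l' <= b -> b' <= c -> c' <= i + #|T| ->
    e (u i') (u j') -> e (u i) (u l') -> e (u j) (u l) ->
    e (u a') (u b') -> e (u a) (u c') ->
  ~~ e (u b) (u c).
Proof.
move=> gi ga gj gl gb gc i'a a'j j'l l'b b'c c'n ei'j' eil' ejl ea'b' eac'.
apply/negP => ebc; move: ei'j'; rewrite e_sym; apply/negP.
apply: (@no_walk_off_gaps i i' [:: (a, a'); (j, j'); (l, l'); (b, b'); (c, c')]
  (seg i' a ++ seg c' (i + #|T|) ++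
   seg l' b ++ rev (seg b' c) ++ seg a' j ++ rev (seg j' l))) => //.
  rewrite !segs_cons perm_cat2l; apply/permP => p; rewrite !count_cat !count_rev.
  move: (count p _) (count p _) (count p _) (count p _) (count p _); clear.
  by move=> n1 n2 n3 n4 n5; lia.
rewrite !map_cat; apply: (walk_cat (walk_seg _) eac') => //.
apply: (@walk_cat _ _ _ (u i) (u l')); [|done|].
  by rewrite -[u i]u_periodic; apply: walk_seg.
apply: (walk_cat (walk_seg _) ebc) => //.
apply: (@walk_cat _ _ _ (u b') (u a')); [exact: walk_rev_seg|by rewrite e_sym|].
apply: (walk_cat (walk_seg _) ejl) => //.
exact: walk_rev_seg.
Qed.

(** * Blocks of the Hamilton cycle and colours of chords *)

Variables N z : nat.
Hypothesis w_z : 2 * z <= w.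
Hypothesis N_w : w * N <= #|T|.

(** Offsets are even so that two different offsets in a clean block always bound a gap. *)
Definition block_vertex (J : 'I_N) (c : nat) : T := u (w * J + 2 * c).

Definition clean (B : {set 'I_N}) : Prop :=
  forall (J : 'I_N) p, J \in B -> p < w -> high (u (w * J + p)).

(** Offsets s and t bound a gap in each of the two blocks, and the two chords would join these gaps
    as excluded by [no_crossing_chords]. *)
Lemma one_color_per_pair (B : {set 'I_N}) (J K : 'I_N) s t :
    clean B -> J \in B -> K \in B -> s < z -> t < z -> s != t ->
    e (block_vertex J s) (block_vertex K s) ->
  ~~ e (block_vertex J t) (block_vertex K t).
Proof.
move=> cleanB JB KB sz tz st eJKs; apply/negP => eJKt.
have JK : J != K by apply: contraTneq eJKs => ->; rewrite e_irr.
have block_gap (I : 'I_N) a b : I \in B -> a < b -> b < z ->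
    gap (w * I + 2 * a) (w * I + 2 * b).
  move=> IB ab bz; split; try lia.
  move=> p Ip; have -> : p = w * I + (p - w * I) by lia.
  by apply: cleanB => //; lia.
have no_lt (I I' : 'I_N) a b : I \in B -> I' \in B -> I < I' -> a < b -> b < z ->
    e (block_vertex I a) (block_vertex I' a) ->
    e (block_vertex I b) (block_vertex I' b) -> False.
  move=> IB I'B II' ab bz; rewrite /block_vertex => ea eb.
  have wI : w * I.+1 <= w * I' by rewrite leq_mul2l II' orbT.
  have wI' : w * I'.+1 <= w * N by rewrite leq_mul2l ltn_ord orbT.
  move: eb; apply/negP; rewrite !mulnS in wI wI'.
  apply: (no_crossing_chords (block_gap I a b IB ab bz)
    (block_gap I' a b I'B ab bz) _ _ ea); lia.
have esym a := e_sym (block_vertex K a) (block_vertex J a).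
have [JltK|KltJ] : J < K \/ K < J by move: JK; rewrite neq_ltn => /orP.
- have [st'|ts'] : s < t \/ t < s by move: st; rewrite neq_ltn => /orP.
  + exact: (no_lt J K s t).
  + exact: (no_lt J K t s).
- have [st'|ts'] : s < t \/ t < s by move: st; rewrite neq_ltn => /orP.
  + by apply: (no_lt K J s t) => //; rewrite esym.
  + by apply: (no_lt K J t s) => //; rewrite esym.
Qed.

(** * Rainbow triangles in the cyclic order of the blocks *)

Section CyclicOrder.
Variables (B : {set 'I_N}) (J0 : 'I_N).
Hypothesis J0B : J0 \in B.
Hypothesis cleanB : clean B.

Let M := #|B|.
Definition nth_block (i : nat) : 'I_N := nth J0 (enum B) (i %% M).
(** Each turn around B adds one period of u, so positions increase with the block index and any
    block can serve as the starting point. *)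
Definition pos (i a : nat) : nat :=
  w * nth_block i + (i %/ M) * #|T| + 2 * a.

Lemma M_gt0 : 0 < M.
Proof. by rewrite card_gt0; apply/set0Pn; exists J0. Qed.

Lemma nth_block_in i : nth_block i \in B.
Proof. by rewrite -mem_enum mem_nth // -cardE ltn_pmod // M_gt0. Qed.

Lemma u_periodicM p m : u (p + m * #|T|) = u p.
Proof. by elim: m => [|m IHm]; rewrite ?addn0 // mulSnr addnA u_periodic. Qed.

Lemma u_pos i a : u (pos i a) = block_vertex (nth_block i) a.
Proof. by rewrite /pos addnAC u_periodicM. Qed.

Lemma enum_block_sorted : sorted (relpre val ltn) (enum B).
Proof.
rewrite /enum_mem sorted_filter //; first by move=> x y t; apply: ltn_trans.
by rewrite -enumT -sorted_map val_enum_ord iota_ltn_sorted.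
Qed.

Lemma pos_lt i j a : i < j -> a < z -> pos i a < pos j 0.
Proof.
move=> ij az; rewrite /pos.
have leN := ltn_ord (nth_block i).
have: i %/ M <= j %/ M by apply: leq_div2r; exact: ltnW.
rewrite leq_eqVlt => /orP[/eqP eqd|ltd].
  have ltm : i %% M < j %% M.
    by move: ij; rewrite {1}(divn_eq i M) {1}(divn_eq j M) eqd; lia.
  have : nth_block i < nth_block j.
    apply: (sorted_ltn_nth _ J0 enum_block_sorted) => //.
    - by move=> x y t; apply: ltn_trans.
    - by rewrite inE -cardE ltn_pmod // M_gt0.
    - by rewrite inE -cardE ltn_pmod // M_gt0.
  by rewrite eqd; nia.
(* A later turn adds at least [#|T|], while [w * N <= #|T|] keeps every block within one turn. *)
by nia.
Qed.

Lemma pos_period i a : pos (i + M) a = pos i a + #|T|.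
Proof.
rewrite /pos /nth_block modnDr divnDr // divnn M_gt0 mulnDl mul1n; lia.
Qed.

Lemma pos_gap i a b : a < b -> b < z -> gap (pos i a) (pos i b).
Proof.
move=> ab bz; rewrite /pos; set m := _ * #|T|; set J := nth_block i.
split; try lia.
move=> p Ip; have -> : p = w * J + (p - (w * J + m)) + m by lia.
by rewrite u_periodicM; apply: cleanB; [exact: nth_block_in|lia].
Qed.

Variable lo : nat.

(** The apex is block i. The threshold lo puts c below s and d below t, so each of the three blocks
    contains a gap between the two ends of edges in it. *)
Definition rainbow (i x y : nat) : Prop := exists s t c d,
  [/\ s != t, lo <= s < z, lo <= t < z, c < lo & d < lo] /\
  [/\ e (u (pos i s)) (u (pos (i + x) s)),
      e (u (pos i t)) (u (pos (i + y) t)) &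
      e (u (pos (i + x) c)) (u (pos (i + y) d))].

Lemma pos_mono i a b : a <= b -> pos i a <= pos i b.
Proof. by rewrite /pos; lia. Qed.

Lemma pos_le i j a b : i < j -> a < z -> pos i a <= pos j b.
Proof.
move=> ij az; apply: leq_trans (ltnW (pos_lt ij az)) _.
exact: pos_mono.
Qed.

Lemma pos_wrap i j a b : j < i + M -> a < z -> pos j a <= pos i b + #|T|.
Proof. by move=> ij az; rewrite -pos_period; apply: pos_le. Qed.

(** If s < t, the gaps s..t, c..s and d..t form the configuration of [no_interlaced_triangle]. Hence
    the block nearer to the apex carries the larger colour. *)
Lemma rainbow_order i x y : 0 < x < y -> y < M -> rainbow i x y ->
  exists s t c d,
  [/\ t < s, lo <= s < z, lo <= t < z, c < lo & d < lo] /\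
  [/\ e (u (pos i s)) (u (pos (i + x) s)),
      e (u (pos i t)) (u (pos (i + y) t)) &
      e (u (pos (i + x) c)) (u (pos (i + y) d))].
Proof.
move=> xy yM [s [t [c [d [[st sz tz cl dl] [es et ecd]]]]]].
exists s, t, c, d; do !split=> //.
rewrite ltnNge leq_eqVlt (negbTE st) /=; apply/negP => lts.
suff : ~~ e (u (pos (i + x) c)) (u (pos (i + y) d)) by rewrite ecd.
apply: (no_interlaced_triangle (i := pos i s) (i' := pos i t)
  (j' := pos (i + x) s) (l' := pos (i + y) t)) => //.
all: try by [apply: pos_gap; lia | apply: pos_le; lia | apply: pos_wrap; lia].
Qed.

(** The six blocks come in the order of [no_two_triangles]: [1 < x] puts the second apex before
    block [i + x], [y <= x'] puts the rest of the second triangle after the first, and [y' < M.-1]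
    stops it before the return to i. *)
Lemma rainbow_consecutive i x y x' y' :
    1 < x < y -> y <= x' < y' -> y' < M.-1 ->
  rainbow i x y -> rainbow i.+1 x' y' -> False.
Proof.
move=> xy x'y' y'M.
have xy1 : 0 < x < y by lia.
have x'y'1 : 0 < x' < y' by lia.
have [yM y'M1] : y < M /\ y' < M by lia.
move=> /(rainbow_order xy1 yM)[s [t [c [d [[st sz tz cl dl] [es et ecd]]]]]].
move=> /(rainbow_order x'y'1 y'M1).
move=> [s' [t' [c' [d' [[st' sz' tz' cl' dl'] [es' et' ecd']]]]]].
move: ecd'; apply/negP.
apply: (no_two_triangles (i := pos i t) (i' := pos i s)
  (a := pos i.+1 t') (a' := pos i.+1 s')
  (j := pos (i + x) c) (j' := pos (i + x) s)
  (l := pos (i + y) d) (l' := pos (i + y) t)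
  (b' := pos (i.+1 + x') s') (c' := pos (i.+1 + y') t')) => //.
all: try by [apply: pos_gap; lia | apply: pos_le; lia | apply: pos_wrap; lia].
Qed.

(* If y0 is the least length of a rainbow triangle, with apex i, then the next
   apex has none of length < y0, nor, by rainbow_consecutive, any beyond y0. *)
Lemma rainbow_free_apex : exists i y0, forall x y,
  1 < x < y -> y < M.-1 -> y < y0 \/ y0 <= x -> ~ rainbow i x y.
Proof.
apply: contrapT => noapex.
suff no_rainbow y i x : 1 < x < y -> y < M.-1 -> ~ rainbow i x y.
  by apply: noapex; exists 0, 0 => x y xy yM _; apply: no_rainbow.
elim/ltn_ind: y i x => y IHy i x xy yM rb; apply: noapex; exists i.+1, y.
move=> x' y' x'y' y'M [ly|lx] rb'.
  by apply: (IHy y' ly i.+1 x').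
by apply: (rainbow_consecutive xy _ y'M rb rb'); lia.
Qed.

Lemma nth_block_onto i J : J \in B -> exists2 x, x < M & nth_block (i + x) = J.
Proof.
move=> JB; have M0 := M_gt0; set m := index J (enum B).
have mM : m < M by rewrite /M cardE index_mem mem_enum.
exists ((m + (M - i %% M)) %% M); first by rewrite ltn_pmod.
rewrite /nth_block modnDmr.
have -> : i + (m + (M - i %% M)) = (i %/ M).+1 * M + m.
  have := ltn_pmod i M0; rewrite {1}(divn_eq i M) mulSn; lia.
by rewrite modnMDl modn_small // nth_index // mem_enum.
Qed.

End CyclicOrder.

(** A is the apex of [rainbow_free_apex], and the ranges are the distances below y0 and from y0 on.
    The two blocks that may be left out are the cyclic neighbours of A, at distances 1 and
    [#|B|.-1]. *)
Lemma separated_ranges (B : {set 'I_N}) (lo : nat) : clean B -> B != set0 ->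
  exists (A : 'I_N) (F : bool -> {set 'I_N}),
  [/\ A \in B, forall b, F b \subset B,
      #|B :\ A :\: (F true :|: F false)| <= 2 &
      forall b (J K : 'I_N) s t c d, J \in F b -> K \in F b -> J != K ->
        s != t -> lo <= s < z -> lo <= t < z -> c < lo -> d < lo ->
        e (block_vertex A s) (block_vertex J s) ->
        e (block_vertex A t) (block_vertex K t) ->
        ~~ e (block_vertex J c) (block_vertex K d)].
Proof.
move=> cleanB /set0Pn[J0 J0B].
have [i [y0 free]] := rainbow_free_apex J0B cleanB lo.
pose bl x := nth_block B J0 (i + x).
exists (bl 0), (fun b => [set bl (val x) | x : 'I_#|B| &
  [&& 1 < x, x < #|B|.-1 & (x < y0) == b]]).
have blB x : bl x \in B by apply: nth_block_in.
have bl0 : nth_block B J0 i = bl 0 by rewrite /bl addn0.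
split=> //.
- by move=> b; apply/subsetP => _ /imsetP[x _ ->].
- apply: (@leq_trans #|[set bl 1; bl #|B|.-1]|); last first.
    by rewrite cards2; case: (_ == _).
  apply/subset_leq_card/subsetP => J.
  rewrite !inE negb_or => /andP[/andP[JF1 JF2] /andP[JA JB]].
  have [x xM xJ] := nth_block_onto J0B i JB.
  rewrite -/(bl x) in xJ; rewrite -xJ in JF1 JF2 JA *.
  have x0 : x != 0 by apply: contraNneq JA => ->.
  have [->|x1] := eqVneq x 1; first by rewrite eqxx.
  have [->|xl] := eqVneq x #|B|.-1; first by rewrite eqxx orbT.
  have xr : (1 < x) && (x < #|B|.-1) by lia.
  suff: false by [].
  have [xy|xy] := boolP (x < y0).
    move/negP: JF1; case; apply/imsetP; exists (Ordinal xM) => //.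
    by rewrite inE /= andbA xr xy.
  move/negP: JF2; case; apply/imsetP; exists (Ordinal xM) => //.
  by rewrite inE /= andbA xr (negbTE xy).
move=> b J K s t c d /imsetP[x]; rewrite inE => /and3P[x1 xM /eqP xb] ->.
move=> /imsetP[y]; rewrite inE => /and3P[y1 yM /eqP yb] -> JK st sz tz cl dl.
move=> es et; apply/negP => ecd.
have xyb : x < y0 /\ y < y0 \/ y0 <= x /\ y0 <= y.
  by case: (b) xb yb => xb yb; [left | right]; lia.
have [xy|yx|xy] := ltngtP x y; last by rewrite (val_inj xy) eqxx in JK.
- apply: (free x y); [by rewrite x1|by []|by case: xyb => -[]; [left|right]|].
  exists s, t, c, d; split=> //.
  by rewrite !u_pos bl0.
- apply: (free y x); [by rewrite y1|by []|by case: xyb => -[]; [left|right]|].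
  exists t, s, d, c; split; first by rewrite eq_sym.
  by rewrite !u_pos bl0 [e (block_vertex _ d) _]e_sym.
Qed.

(** * Independence numbers of families of blocks *)

Lemma block_vertex_inj (J K : 'I_N) c d : c < z -> d < z ->
  block_vertex J c = block_vertex K d -> J = K /\ c = d.
Proof.
move=> cz dz eqJK.
have wJ : w * J.+1 <= w * N by rewrite leq_mul2l ltn_ord orbT.
have wK : w * K.+1 <= w * N by rewrite leq_mul2l ltn_ord orbT.
have eqp : w * J + 2 * c = w * K + 2 * d.
  rewrite !mulnS in wJ wK.
  by apply: (u_inj (b := 0)) eqJK; rewrite inE; lia.
have JK : (J : nat) = K.
  have [JK|KJ|//] := ltngtP J K.
    have : w * J.+1 <= w * K by rewrite leq_mul2l JK orbT.
    by rewrite mulnS; lia.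
  have : w * K.+1 <= w * J by rewrite leq_mul2l KJ orbT.
  by rewrite mulnS; lia.
by split; [exact: val_inj | move: eqp; rewrite JK; lia].
Qed.

Definition block_vertices (B : {set 'I_N}) (lo : nat) : {set T} :=
  [set x | [exists J in B, exists c : 'I_lo, x == block_vertex J c]].

Lemma block_verticesP (B : {set 'I_N}) lo x :
  reflect (exists J c, [/\ J \in B, c < lo & x = block_vertex J c])
    (x \in block_vertices B lo).
Proof.
rewrite inE; apply: (iffP exists_inP) => [[J JB /existsP[c /eqP xE]]|].
  by exists J, c.
move=> [J [c [JB clo xE]]]; exists J => //; apply/existsP.
by exists (Ordinal clo); apply/eqP.
Qed.

Lemma block_verticesS (B B' : {set 'I_N}) lo lo' : B \subset B' -> lo <= lo' ->
  block_vertices B lo \subset block_vertices B' lo'.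
Proof.
move=> /subsetP sBB' lelo; apply/subsetP => x /block_verticesP[J [c [JB clo ->]]].
by apply/block_verticesP; exists J, c; split; [exact: sBB'|lia|].
Qed.

Definition independence_le (S : {set T}) (kappa : nat) : Prop :=
  forall X : {set T}, X \subset S -> independent e X -> #|X| <= kappa.

Definition color_nbrs (B : {set 'I_N}) (J : 'I_N) (c : nat) : {set 'I_N} :=
  [set K in B | e (block_vertex J c) (block_vertex K c)].

(** Blocks pairwise unrelated in one colour give an independent set of the graph, namely their
    vertices at that offset; so kappa bounds the independent sets of every colour. *)
Lemma many_colors_with_large_degree (B : {set 'I_N}) lo h d kappa :
    lo + h <= z -> independence_le (block_vertices B (lo + h)) kappa ->
    2 * d * kappa < #|B| ->
  exists B' : {set 'I_N}, [/\ B' \subset B, B' != set0 & forall J, J \in B' ->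
    h <= 2 * #|[set c : 'I_h | d <= #|color_nbrs B' J (lo + c)|]|].
Proof.
move=> hz kappaB ltB.
apply: (@many_relations_with_large_degree _ h d kappa (fun c J K =>
  e (block_vertex J (lo + c)) (block_vertex K (lo + c)))) => //.
- by move=> c J K; rewrite e_sym.
- by move=> c J; rewrite e_irr.
move=> c X sXB indX; have cz : lo + c < z by have := ltn_ord c; lia.
have bv_inj : injective (block_vertex^~ (lo + c)).
  by move=> J K /(block_vertex_inj cz cz)[].
rewrite -(card_imset (mem X) bv_inj); apply: kappaB.
  apply/subsetP => _ /imsetP[J XJ ->]; apply/block_verticesP.
  by exists J, (lo + c); split=> //; [exact: (subsetP sXB) | rewrite ltn_add2l].
apply/forall_inP => _ /imsetP[J XJ ->]; apply/forall_inP => _ /imsetP[K XK ->].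
exact: (forall_inP (forall_inP indX J XJ)).
Qed.

Lemma color_nbrs_disjoint (B : {set 'I_N}) (J K L : 'I_N) s t :
    clean B -> J \in B -> s < z -> t < z -> s != t ->
    K \in color_nbrs B J s -> L \in color_nbrs B J t -> K != L.
Proof.
move=> cleanB JB sz tz st; rewrite !inE => /andP[KB eJK] /andP[_ eJL].
apply: contraTneq eJL => <-.
exact: (one_color_per_pair cleanB JB KB sz tz st).
Qed.

Lemma independence_le_refine (B : {set 'I_N}) lo g q kappa kappa' :
    clean B -> lo + 4 * g <= z ->
    independence_le (block_vertices B (lo + 4 * g)) kappa ->
    2 * (2 * q + 2) * kappa < #|B| -> kappa < g * kappa'.+1 ->
  exists A : {set 'I_N},
    [/\ A \subset B, q <= #|A| & independence_le (block_vertices A lo) kappa'].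
Proof.
move=> cleanB gz kappaB ltB ltkappa.
have [B' [sB'B B'0 degB']] := many_colors_with_large_degree gz kappaB ltB.
have cleanB' : clean B' by move=> J p /(subsetP sB'B); apply: cleanB.
have [a [F [aB' sFB' cardF sepF]]] := separated_ranges lo cleanB' B'0.
pose Nb (c : 'I_(4 * g)) := color_nbrs B' a (lo + c).
(* At most two neighbours escape both ranges, so a class of this size has q members in one range. *)
pose G := [set c | 2 * q + 2 <= #|Nb c|].
have cardG : 2 * g <= #|G| by have := degB' a aB'; rewrite -/G; lia.
pose H b := [set c in G | q <= #|Nb c :&: F b|].
have sGH : G \subset H true :|: H false.
  apply/subsetP => c Gc; rewrite !inE; move: (Gc); rewrite inE => -> /=.
  rewrite leqNgt; case: ltnP => //= ltT; rewrite leqNgt; apply/negP => ltF.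
  have sub : Nb c \subset (B' :\ a :\: (F true :|: F false)) :|:
      ((Nb c :&: F true) :|: (Nb c :&: F false)).
    apply/subsetP => K NK; rewrite -setIUr in_setU in_setI NK in_setD.
    have [_|_] := boolP (K \in _); first by rewrite orbT.
    move: NK; rewrite in_setD1 inE => /andP[-> eaK]; rewrite !andbT orbF.
    by apply: contraTneq eaK => ->; rewrite e_irr.
  have := subset_leq_card sub; rewrite inE in Gc.
  have [+ _] := leq_card_setU (Nb c :&: F true) (Nb c :&: F false).
  have [+ _] := leq_card_setU (B' :\ a :\: (F true :|: F false))
    ((Nb c :&: F true) :|: (Nb c :&: F false)).
  move=> leU leV leNb.
  have arith (n a' m t f : nat) : a' <= 2 -> t < q -> f < q -> 2 * q + 2 <= n ->
    n <= a' + m -> m <= t + f -> False by lia.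
  exact: arith cardF ltT ltF Gc (leq_trans leNb leU) leV.
have [b cardH] : exists b, g <= #|H b|.
  have := subset_leq_card sGH; have [+ _] := leq_card_setU (H true) (H false).
  have [|] := leqP g #|H true|; [by exists true | exists false; lia].
apply: contrapT => noA.
pose large c (X : {set T}) := [&& X \subset block_vertices (Nb c :&: F b) lo,
  independent e X & kappa' < #|X|].
(* A large independent set for each colour of [H b]; the empty default lets the union run over all
   colours. *)
pose Z c := if c \in H b then odflt set0 [pick X | large c X] else set0.
have ZP c : c \in H b -> large c (Z c).
  rewrite /Z => Hc; rewrite Hc; case: pickP => //= nolarge; case: noA.
  exists (Nb c :&: F b); split; last first.
  - move=> X sX indX; rewrite leqNgt; apply/negP => ltX.
    by move: (nolarge X); rewrite /large sX indX ltX.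
  - by move: Hc; rewrite inE => /andP[].
  - by apply: subset_trans (subsetIr _ _) (subset_trans (sFB' b) sB'B).
have ZE c x : x \in Z c -> exists J i, [/\ c \in H b, J \in Nb c, J \in F b,
    i < lo & x = block_vertex J i].
  have [Hc|Hc] := boolP (c \in H b); last by rewrite /Z (negbTE Hc) inE.
  have /and3P[/subsetP sZ _ _] := ZP c Hc.
  case/sZ/block_verticesP=> J [i [/setIP[JN JF] ilo ->]].
  by exists J, i.
have lt_z (c : 'I_(4 * g)) : lo + c < z by have := ltn_ord c; lia.
have Z_sep c d x y : c != d -> x \in Z c -> y \in Z d -> x != y /\ ~~ e x y.
  move=> cd /ZE[J [i [_ JN JF ilo ->]]] /ZE[K [j [_ KN KF jlo ->]]].
  have cd' : lo + c != lo + d by rewrite eqn_add2l.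
  have JK : J != K by apply: color_nbrs_disjoint cleanB' aB' _ _ cd' JN KN.
  split; last first.
    move: JN KN; rewrite !inE => /andP[_ eJ] /andP[_ eK].
    by apply: (sepF b J K (lo + c) (lo + d)); rewrite ?leq_addr ?lt_z.
  by apply: contraNneq JK => /block_vertex_inj[||-> //]; lia.
have cardZ : #|\bigcup_c Z c| = \sum_c #|Z c|.
  rewrite -sum1_card partition_disjoint_bigcup; last first.
    move=> c d cd; rewrite -setI_eq0; apply/eqP/setP => x; rewrite !inE.
    apply/negP => /andP[xc xd]; have [] := Z_sep c d x x cd xc xd.
    by rewrite eqxx.
  by apply: eq_bigr => c _; rewrite sum1_card.
have indZ : independent e (\bigcup_c Z c).
  apply/forall_inP => x /bigcupP[c _ xc]; apply/forall_inP => y /bigcupP[d _ yd].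
  have [cd|cd] := eqVneq c d; last by have [] := Z_sep c d x y cd xc yd.
  have [_ [_ [Hc _ _ _ _]]] := ZE c x xc; have /and3P[_ indZc _] := ZP c Hc.
  by rewrite -cd in yd; exact: (forall_inP (forall_inP indZc x xc)).
have sZB : \bigcup_c Z c \subset block_vertices B (lo + 4 * g).
  apply/subsetP => x /bigcupP[c _ /ZE[J [i [_ _ JF ilo ->]]]].
  apply/block_verticesP; exists J, i; split=> //; last by lia.
  by apply: (subsetP sB'B); apply: (subsetP (sFB' b)).
have := kappaB _ sZB indZ; rewrite cardZ leqNgt => /negP; apply.
apply: leq_trans ltkappa _; apply: leq_trans (leq_mul cardH (leqnn _)) _.
rewrite -sum_nat_const [leqRHS](bigID (mem (H b))) /=.
apply: leq_trans (leq_addr _ _); apply: leq_sum => c Hc.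
by have /and3P[] := ZP c Hc.
Qed.

(** Some block J has a neighbour in at least half of the h colours. Neighbours in different colours
    differ, so they are at least h / 2 blocks other than J. *)
Lemma no_sparse_blocks (B : {set 'I_N}) h kappa : clean B -> h <= z ->
    independence_le (block_vertices B h) kappa -> 2 * kappa < #|B| ->
  h < 2 * #|B|.
Proof.
move=> cleanB hz kappaB ltB.
have [|B' [sB'B /set0Pn[J JB'] degB']] :=
  @many_colors_with_large_degree B 0 h 1 kappa hz kappaB; first by rewrite muln1.
have cleanB' : clean B' by move=> K p /(subsetP sB'B); apply: cleanB.
apply: leq_ltn_trans (degB' J JB') _; rewrite ltn_pmul2l //.
apply: (@leq_trans #|B'|); last exact: subset_leq_card.
set G := [set c : 'I_h | _].
(* The default J is never taken for colours in G. *)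
pose f (c : 'I_h) := odflt J [pick K in color_nbrs B' J c].
have fP c : c \in G -> f c \in color_nbrs B' J c.
  rewrite inE card_gt0 /f => /set0Pn[K NK].
  by case: pickP => //= /(_ K); rewrite NK.
rewrite (cardsD1 J) JB' add1n ltnS.
have f_inj : {in G &, injective f}.
  move=> c d Gc Gd; apply: contra_eq => cd.
  by apply: color_nbrs_disjoint cleanB' JB' _ _ _ (fP c Gc) (fP d Gd);
    rewrite ?(leq_trans (ltn_ord _)).
rewrite -(card_in_imset f_inj); apply/subset_leq_card/subsetP.
move=> _ /imsetP[c /fP + ->]; rewrite !inE => /andP[fB eJf]; rewrite fB andbT.
by apply: contraTneq eJf => ->; rewrite e_irr.
Qed.

(** * Lower and upper bounds on the number of clean blocks *)

Lemma card_low : #|[set x | ~~ high x]| <= (k + 6 * w).+1 * k.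
Proof.
(* Low vertices have degree at most [k + 6 * w] in the whole graph, hence in every subset. *)
have deg_low : degenerate e (k + 6 * w).+1 [set x | ~~ high x].
  move=> S' sS' /set0Pn[x Sx]; exists x => //.
  have := subsetP sS' x Sx; rewrite inE -leqNgt ltnS; apply: leq_trans.
  by apply/subset_leq_card/subsetP => y; rewrite !inE => /andP[].
have [X [_ indX leX]] := degenerate_independent e_sym e_irr deg_low.
rewrite (leq_trans leX) // leq_mul2l (leq_trans _ alpha_k) ?orbT //.
exact: leq_bigmax_cond.
Qed.

(** Every other block contains a low vertex, and blocks are disjoint, so [card_low] bounds their
    number. *)
Lemma many_clean_blocks : exists B : {set 'I_N},
  clean B /\ N <= #|B| + (k + 6 * w).+1 * k.
Proof.
pose B := [set J : 'I_N | [forall p : 'I_w, high (u (w * J + p))]].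
exists B; split=> [J p|].
  by rewrite inE => /forallP highJ pw; apply: (highJ (Ordinal pw)).
rewrite -[N in N <= _]card_ord -(cardsC B) leq_add2l.
apply: leq_trans card_low.
pose f (J : 'I_N) :=
  odflt (u 0) (omap (fun p : 'I_w => u (w * J + p))
                [pick p : 'I_w | ~~ high (u (w * J + p))]).
have fP (J : 'I_N) : J \in ~: B -> exists p : 'I_w,
    f J = u (w * J + p) /\ ~~ high (u (w * J + p)).
  rewrite !inE => /forallPn[p0 lowp0]; rewrite /f.
  by case: pickP => [p lowp|/(_ p0)]; [exists p | rewrite lowp0].
have f_inj : {in ~: B &, injective f}.
  move=> J K /fP[p [-> _]] /fP[p' [-> _]] eqJK.
  have wJ : w * J.+1 <= w * N by rewrite leq_mul2l ltn_ord orbT.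
  have wK : w * K.+1 <= w * N by rewrite leq_mul2l ltn_ord orbT.
  have := ltn_ord p; have := ltn_ord p' => p'w pw; rewrite !mulnS in wJ wK.
  have w0 : 0 < w by lia.
  have eqp : w * J + p = w * K + p'.
    by apply: (u_inj (b := 0)) eqJK; rewrite inE; lia.
  apply: val_inj => /=; have := congr1 (divn^~ w) eqp.
  by rewrite ![w * _]mulnC !divnMDl // !divn_small // !addn0.
rewrite -(card_in_imset f_inj); apply/subset_leq_card/subsetP.
by move=> _ /imsetP[J /fP[p [-> lowp]] ->]; rewrite inE.
Qed.

(** Two refinements with g = 2t lower the offset range from 24t to 16t to 8t and the independence
    bound from k to at most t^2 / 2 to at most t / 4. From 60 t^6 blocks, 12 t^3 and then 4t
    survive. *)
Lemma few_clean_blocks (t : nat) (B : {set 'I_N}) : 0 < t -> k <= t ^ 3 ->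
  24 * t <= z -> clean B -> #|B| < 60 * t ^ 6.
Proof.
move=> t0 kt tz cleanB; rewrite ltnNge; apply/negP => leB.
pose kappa1 := k %/ (2 * t); pose kappa2 := kappa1 %/ (2 * t).
have t6 : t ^ 6 = t ^ 3 * t ^ 3 by rewrite -expnD.
have t3_gt0 : 0 < t ^ 3 by rewrite expn_gt0 t0.
have k1 : 2 * kappa1 <= t ^ 2.
  have lek := leq_trans (leq_trunc_div k (2 * t)) kt.
  by rewrite -(leq_pmul2l t0) -expnS mulnCA mulnA mulnC.
have k2 : 2 * (2 * kappa2) <= t.
  have lek := leq_trunc_div kappa1 (2 * t); rewrite -/kappa2 in lek.
  rewrite -(leq_pmul2l t0); apply: leq_trans k1.
  by rewrite mulnCA leq_mul2l /= mulnCA mulnA mulnC.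
have alphaB : independence_le (block_vertices B (16 * t + 4 * (2 * t))) k.
  by move=> X _ indX; apply: leq_trans alpha_k; apply: leq_bigmax_cond.
have [|||B1 [sB1 leB1 alphaB1]] :=
  independence_le_refine (q := 12 * t ^ 3) (kappa' := kappa1) cleanB _ alphaB.
- lia.
- by apply: leq_trans leB; rewrite t6; nia.
- by rewrite mulnC; apply: ltn_ceil; rewrite muln_gt0.
have cleanB1 : clean B1 by move=> J p /(subsetP sB1); apply: cleanB.
have alphaB1' : independence_le (block_vertices B1 (8 * t + 4 * (2 * t))) kappa1.
  by have -> : 8 * t + 4 * (2 * t) = 16 * t by lia.
have [|||B2 [sB2 leB2 alphaB2]] :=
  independence_le_refine (q := 4 * t) (kappa' := kappa2) cleanB1 _ alphaB1'.
- lia.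
- by apply: leq_trans leB1; move: k1; rewrite (expnS t 2); nia.
- by rewrite mulnC; apply: ltn_ceil; rewrite muln_gt0.
(* Trimming to exactly 4t blocks makes [no_sparse_blocks] with h = 8t fail, while 4t still exceeds
   [2 * kappa2]. *)
pose B3 := [set J in take (4 * t) (enum B2)].
have cardB3 : #|B3| = 4 * t.
  rewrite cardsE (card_uniqP _) ?take_uniq ?enum_uniq //.
  by rewrite size_takel // -cardE.
have sB3 : B3 \subset B2.
  by apply/subsetP => J; rewrite inE => /mem_take; rewrite mem_enum.
have cleanB3 : clean B3.
  by move=> J p /(subsetP sB3)/(subsetP sB2); apply: cleanB1.
suff : 8 * t < 2 * #|B3| by rewrite cardB3; lia.
apply: (no_sparse_blocks (kappa := kappa2) cleanB3); first by lia.
  move=> X sX; apply: alphaB2; apply: subset_trans sX _.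
  exact: block_verticesS.
by rewrite cardB3; lia.
Qed.

End HamiltonCycle.

(** * Choice of parameters and the final bound *)

Lemma hamiltonian_enumeration (T : finType) (e : rel T) : hamiltonian e ->
  exists u : nat -> T, [/\ forall i, e (u i) (u i.+1),
    forall i, u (i + #|T|) = u i &
    forall b, {in [pred i | b <= i < b + #|T|] &, injective u}].
Proof.
case=> -[|x p] [gt2 /andP[cyc_s uniq_s]] all_s //.
have sizeT : #|T| = (size p).+1.
  rewrite -[RHS]/(size (x :: p)) -(card_uniqP uniq_s).
  by apply: eq_card => y; rewrite all_s.
have T0 : 0 < #|T| by rewrite sizeT.
exists (fun i => nth x (x :: p) (i %% #|T|)); split=> [i|i|b i j].
- have -> : i.+1 %% #|T| = (i %% #|T|).+1 %% #|T|.
    by rewrite -[in RHS]addn1 modnDml addn1.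
  move: (i %% #|T|) (ltn_pmod i T0) => m ltm.
  move: cyc_s => /= /(pathP x)/(_ m); rewrite size_rcons -sizeT => /(_ ltm).
  rewrite -rcons_cons nth_rcons /= -sizeT ltm nth_rcons.
  have [lt|le] := ltnP m (size p); first by rewrite modn_small // sizeT.
  have -> : m = size p by apply/eqP; rewrite eqn_leq le andbT -ltnS -sizeT.
  by rewrite eqxx -sizeT modnn.
- by rewrite modnDr.
rewrite !inE => /andP[bi ib] /andP[bj jb] /eqP.
rewrite nth_uniq //= -?sizeT ?ltn_pmod // -(subnKC bi) -(subnKC bj) eqn_modDl.
by rewrite !modn_small ?ltn_subLR // => /eqP ->.
Qed.

Lemma cycle_of_length_pred (T : finType) (e : rel T) (k t : nat) :
    simple_graph e -> hamiltonian e -> independence_number e <= k ->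
    0 < t -> k <= t ^ 3 -> 350 * 48 * t ^ 7 <= #|T| ->
  has_cycle_of_length e (#|T| - 1).
Proof.
case=> e_sym e_irr /hamiltonian_enumeration[u [u_edge u_periodic u_inj]].
move=> alpha_k t0 kt leT; apply: contrapT => no_cycle.
have t3_gt0 : 0 < t ^ 3 by rewrite expn_gt0 t0.
have t6 : t ^ 6 = t ^ 3 * t ^ 3 by rewrite -expnD.
have t6_gt0 : 0 < t ^ 6 by rewrite expn_gt0 t0.
have le_t_t3 : t <= t ^ 3 by rewrite -[leqLHS]expn1 leq_pexp2l.
(* Blocks of length 48t hold 24t even offsets, as [few_clean_blocks] requires. *)
pose w := 48 * t; pose N := #|T| %/ w.
have leT' : 350 * t ^ 6 * w <= #|T|.
  by apply: leq_trans leT; rewrite (expnS t 6) [t * _]mulnC mulnACA.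
have wz : 2 * (24 * t) <= w by rewrite /w; lia.
have Nw : w * N <= #|T| by rewrite mulnC leq_trunc_div.
have leN : 350 * t ^ 6 <= N by rewrite leq_divRL // muln_gt0.
have T_large : 6 * w + 2 < #|T| by apply: leq_trans leT'; rewrite /w; nia.
have [B [cleanB leB]] := many_clean_blocks e_sym e_irr u_inj alpha_k T_large wz Nw.
have := few_clean_blocks e_sym e_irr u_edge u_periodic u_inj alpha_k T_large
  no_cycle wz Nw t0 kt (leqnn _) cleanB.
apply/negP; rewrite -leqNgt.
(* Here k <= t^3 and 6w + 1 = 288t + 1 <= 289 t^3. Of at least 350 t^6 blocks, at least 60 t^6 are
   therefore clean. *)
have : (k + 6 * w).+1 * k <= 290 * t ^ 3 * t ^ 3.
  by apply: leq_mul => //; move: (t ^ 3) kt t3_gt0 le_t_t3 => a; rewrite /w; lia.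
by move: leN leB; rewrite -mulnA -t6; lia.
Qed.

(** The least t with k <= t^3 works: (t - 1)^3 < k, and t <= 2 (t - 1) unless t = 1. *)
Lemma exists_cube_between (k : nat) : 0 < k ->
  exists t, [/\ 0 < t, k <= t ^ 3 & t ^ 3 <= 8 * k].
Proof.
move=> k0; have ex_t : exists t, k <= t ^ 3.
  by exists k; rewrite -[leqLHS]expn1 leq_pexp2l.
have [[|t] kt tmin] := ex_minnP ex_t; first by move: kt; rewrite exp0n //; lia.
exists t.+1; split=> //.
have ltk : t ^ 3 < k by rewrite ltnNge; apply/negP => /tmin; rewrite ltnn.
have [->|t0] := posnP t; first by rewrite exp1n; lia.
by move: ltk; rewrite !expnS !expn0; nia.
Qed.

Unset Implicit Arguments.

Local Open Scope ring_scope.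

Theorem theorem1p2 (R : realType) :
  exists c : R,
    forall k : nat, (0 < k)%N ->
    forall (T : finType) (e : rel T),
      simple_graph e ->
      hamiltonian e ->
      c * (k%:R `^ (7%:R / 3%:R)) <= #|T|%:R ->
      (independence_number e <= k)%N ->
      has_cycle_of_length e (#|T| - 1)%N.
Proof.
(* The factor 128 is 8^(7/3): from t^3 <= 8k follows t^7 <= 128 k^(7/3). *)
exists (350 * 48 * 128)%:R => k k0 T e simple_e ham_e leT alpha_k.
have [t [t0 kt tk]] := exists_cube_between k0.
apply: (cycle_of_length_pred simple_e ham_e alpha_k t0 kt).
rewrite -(ler_nat R); apply: le_trans leT.
rewrite [(_ * 128)%N%:R]natrM [(_ * t ^ 7)%N%:R]natrM -mulrA ler_wpM2l ?ler0n //.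
have pow73 (a : R) : 0 <= a -> (a ^+ 3) `^ (7%:R / 3%:R) = a ^+ 7.
  move=> a0; rewrite -powR_mulrn // -powRrM mulrC divfK ?powR_mulrn //.
  by rewrite pnatr_eq0.
have -> : 128%:R = 8%:R `^ (7%:R / 3%:R) :> R.
  by rewrite (natrX R 2 3) pow73 // -natrX.
rewrite -powRM ?ler0n // -natrM natrX -pow73 ?ler0n // -natrX.
by apply: ge0_ler_powR; rewrite ?nnegrE ?divr_ge0 ?ler0n // ler_nat.
Qed.
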